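(* Every tree-like continuum $X$ has exactly $1$ or $2^{\aleph_0}$ meager composants; that is, the set $\mathcal M_X=\{M_x:x\in X\}$ has cardinality $1$ or $2^{\aleph_0}$.
   Context: A continuum is a nonempty compact connected metric space; a subcontinuum of $X$ is a subset of $X$ that is a continuum in the subspace topology (one-point sets are allowed as subcontinua). A continuum $X$ is tree-like if for every $\varepsilon>0$ there are a tree $T$ (a finite connected acyclic topological graph) and a continuous map $f:X\to T$ such that $\mathrm{diam}(f^{-1}\{t\})<\varepsilon$ for each $t\in T$. For a continuum $X$ and $x\in X$, the meager composant of $x$ in $X$ is $M_x=\bigcup\{L\subset X: L$ is a nowhere dense subcontinuum of $X$ and $x\in L\}$. *)

(* Defs.v *)
From HB Require Import structures.
From mathcomp Require Import all_boot all_order all_algebra.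
From mathcomp Require Import all_classical all_reals all_analysis.

Set Implicit Arguments.
Unset Strict Implicit.
Unset Printing Implicit Defensive.

Import Order.TTheory GRing.Theory Num.Theory.
Import numFieldNormedType.Exports.

Local Open Scope classical_set_scope.
Local Open Scope ring_scope.

Definition homeomorphic (S T : topologicalType) : Prop :=
  exists (f : S -> T) (g : T -> S),
    [/\ continuous f, continuous g, cancel f g & cancel g f].

Definition tree_graph (n : nat) (e : rel 'I_n) : Prop :=
  [/\ (0 < n)%N,
      symmetric e,
      irreflexive e,
      forall i j, connect e i j &
      forall c : seq 'I_n, ucycle e c -> (size c <= 2)%N].

(* Geometric realization of a simple graph on 'I_n, in barycentric coordinates:
   vertex i is the i-th unit vector, and an edge {i, j} is the segment joining
   vertices i and j.  The case i = j below accounts for the vertices, which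
   matters only for isolated ones. *)
Definition realization (R : realType) (n : nat) (e : rel 'I_n) :
    set 'rV[R]_n :=
  [set t : 'rV[R]_n | [/\ forall k, 0 <= t ord0 k,
                         \sum_k t ord0 k = 1 &
                         exists i j, (i = j \/ e i j) /\
                           forall k, t ord0 k != 0 -> k = i \/ k = j]].

Definition topological_tree (R : realType) (T : topologicalType) : Prop :=
  exists (n : nat) (e : rel 'I_n),
    tree_graph e /\ homeomorphic T (set_type (@realization R n e)).

Section Continua.
Context {R : realType} {X : metricType R}.

Definition continuum (A : set X) : Prop :=
  [/\ A !=set0, compact A & connected A].

(* Distances being nonnegative, adjoining 0 only serves to give the empty set
   diameter 0 rather than -oo. *)
Definition diam (A : set X) : \bar R :=
  ereal_sup (0%E |` [set (mdist p.1 p.2)%:E | p in A `*` A]).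

Definition nowhere_dense (A : set X) : Prop := interior (closure A) = set0.

Definition meager_composant (x : X) : set X :=
  \bigcup_(L in [set L | [/\ continuum L, nowhere_dense L & L x]]) L.

End Continua.

Definition tree_like_continuum (R : realType) (X : metricType R) : Prop :=
  continuum [set: X] /\
  forall eps : R, 0 < eps ->
    exists (T : topologicalType) (f : X -> T),
      [/\ topological_tree R T, continuous f &
          forall t : T, (diam (f @^-1` [set t]) < eps%:E)%E].

Definition meager_composants (R : realType) (X : metricType R) :
    set (set X) :=
  range (@meager_composant R X).
Arguments meager_composants {R} X.

(* Main.v *)
Require Import Defs.
From HB Require Import structures.
From mathcomp Require Import all_boot all_order all_algebra.
From mathcomp Require Import all_classical all_reals all_analysis.
From mathcomp Require Import ring lra.

Set Implicit Arguments.
Unset Strict Implicit.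
Unset Printing Implicit Defensive.

Import Order.TTheory GRing.Theory Num.Theory.
Import numFieldNormedType.Exports.

Local Open Scope classical_set_scope.

(* In a tree the intersection of two connected sets is connected, and maps with
   small fibers carry this over to a tree-like continuum X: its subcontinua are
   closed under intersection, so every set has a least continuum containing it.
   Hence x and y lie in the same meager composant exactly when the least
   continuum containing both has empty interior.
   If some indecomposable subcontinuum Y has interior, its proper subcontinua
   have empty interior, so "x and y lie in a proper subcontinuum of Y" is a
   countable union of closed relations with nowhere dense sections, and
   Mycielski's scheme yields a Cantor set of pairwise unrelated points; any
   continuum joining two of them contains Y.
   Otherwise, take a and b in different meager composants and let K be the least
   continuum containing them.  Call a pair A <= A' of subcontinua of K through
   a fat when A' \ A has interior in X.  Decomposability makes this order
   dense, so the fat pair ({a}, K) can be split along the binary tree into fat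
   pairs separated by gaps, and continua crossing a gap have interior. *)

(** * Connectedness in compact spaces *)

Section ClosedSets.
Context {T : topologicalType}.
Implicit Types A B C M N : set T.

Lemma connected_closed_split C M N : connected C -> closed M -> closed N ->
  C `<=` M `|` N -> C `&` (M `&` N) = set0 -> C `<=` M \/ C `<=` N.
Proof.
move=> cC cM cN CMN CMN0.
have [CM0|/set0P CM0] := eqVneq (C `&` M) set0.
  right=> x Cx; case: (CMN x Cx) => // Mx.
  by have : (C `&` M) x by []; rewrite CM0.
left; apply/setIidPl; apply: cC => //; last by exists M.
exists (~` N); first exact: closed_openC.
apply/seteqP; split=> x [Cx Mx]; split=> //.
  by move=> Nx; have : (C `&` (M `&` N)) x by []; rewrite CMN0.
by case: (CMN x Cx).
Qed.

(** The closure of either piece of a separation stays in [C] and avoids the other piece, so both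
    pieces are closed. *)
Lemma closed_connectedP C : closed C ->
  (forall M N, closed M -> closed N -> M !=set0 -> N !=set0 ->
     M `|` N = C -> M `&` N = set0 -> False) -> connected C.
Proof.
move=> cC h; apply/connectedP => E [E0 EU [sE1 sE2]].
have cl b : closed (E b).
  have clE : closure (E b) `<=` C.
    rewrite [X in _ `<=` X](closure_id C).1//; apply: closureS.
    by rewrite EU; case: b => x; [right|left].
  apply/closure_id/seteqP; split; first exact: subset_closure.
  move=> x Ex; have := clE _ Ex; rewrite EU; case: b Ex {clE} => Ex [] // Ebx.
    by have : (E false `&` closure (E true)) x by []; rewrite sE2.
  by have : (closure (E false) `&` E true) x by []; rewrite sE1.
apply: (h _ _ (cl false) (cl true)) => //.
by apply/seteqP; split=> // x [Ex Ey]; rewrite -sE2; split=> //;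
  exact: subset_closure.
Qed.

(** Otherwise the parts of the members outside [O] generate a proper filter, and a cluster point of
    it lies in every member but not in [O]. *)
Lemma directed_compact (F : set (set T)) (O : set T) :
  compact [set: T] -> F !=set0 -> (forall A, F A -> closed A) ->
  (forall A B, F A -> F B -> exists2 C, F C & C `<=` A `&` B) ->
  open O -> \bigcap_(A in F) A `<=` O -> exists2 A, F A & A `<=` O.
Proof.
move=> cT [A0 FA0] Fcl Fdir oO FO; apply: contrapT => noA.
have ne A : F A -> (A `\` O) !=set0.
  move=> FA; apply/set0P/eqP; rewrite setD_eq0 => AO.
  by apply: noA; exists A.
pose G := filter_from F (fun A => A `\` O).
have GF : ProperFilter G.
  apply: filter_from_proper => //; apply: filter_from_filter; first by exists A0.
  move=> A B FA FB; have [C FC CAB] := Fdir _ _ FA FB.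
  by exists C => // x [/CAB[? ?] ?].
have [p [_ clp]] := cT G GF (@filterT _ G _).
have Ap A : F A -> (A `\` O) p.
  move=> FA; have cAO : closed (A `\` O).
    by apply: closedI; [exact: Fcl|exact: open_closedC].
  by apply: cAO => U nU; apply: clp => //; exists A.
by have [_] := Ap _ FA0; apply; apply: FO => A /Ap[].
Qed.

End ClosedSets.

Section CompactNormal.
Context {T : topologicalType}.
Hypothesis cT : compact [set: T].
Hypothesis nT : forall A B : set T, closed A -> closed B -> A `&` B = set0 ->
  exists U V, [/\ open U, open V, A `<=` U, B `<=` V & U `&` V = set0].
Implicit Types A B C M N : set T.

(** Disjoint open neighbourhoods of the two pieces of a separation already cover some member of the
    family, which they would disconnect. *)
Lemma directed_connected (F : set (set T)) :
  F !=set0 -> (forall A, F A -> closed A /\ connected A) ->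
  (forall A B, F A -> F B -> exists2 C, F C & C `<=` A `&` B) ->
  connected (\bigcap_(A in F) A).
Proof.
move=> F0 Fc Fdir; apply: closed_connectedP.
  by apply: closed_bigI => A /Fc[].
move=> M N cM cN [m Mm] [n Nn] MN MN0.
have [U [V [oU oV MU NV UV0]]] := nT cM cN MN0.
have [A FA AUV] : exists2 A, F A & A `<=` U `|` V.
  apply: directed_compact => //; [by move=> A /Fc[]|exact: openU|].
  by rewrite -MN => x [/MU|/NV]; [left|right].
have MNA : M `|` N `<=` A by rewrite MN; exact: bigcap_inf.
have [] := @connected_closed_split _ A (~` U) (~` V) (Fc _ FA).2.
- exact: open_closedC.
- exact: open_closedC.
- rewrite -setCI UV0 setC0; exact: subsetT.
- rewrite -setCU; apply/seteqP; split=> // x [Ax nUV]; exact/nUV/AUV.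
- by move=> /(_ m (MNA _ (or_introl Mm))); apply; exact: MU.
- by move=> /(_ n (MNA _ (or_intror Nn))); apply; exact: NV.
Qed.

(** Components are quasi-components here: the intersection [Q] of the relatively clopen parts of [C]
    around [x] is connected, hence inside the component. So [Q] misses [B], and by compactness one
    of these clopen parts does. *)
Lemma component_clopen C B x : closed C -> closed B -> C x ->
  B `&` connected_component C x = set0 ->
  exists D D', [/\ closed D, closed D', D `|` D' = C & D `&` D' = set0] /\
               (D x /\ B `&` D = set0).
Proof.
move=> cC cB Cx BC0.
pose F := [set D | [/\ closed D, D x & exists D',
   [/\ closed D', D `|` D' = C & D `&` D' = set0]]].
have FC : F C.
  by split=> //; exists set0; split; rewrite ?setU0 ?setI0//; exact: closed0.
have FI : forall A A', F A -> F A' -> F (A `&` A').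
  move=> A A' [cA Ax [B1 [cB1 AB AB0]]] [cA' A'x [B2 [cB2 AB' AB0']]].
  split; [exact: closedI| by []|].
  exists ((A `&` B2) `|` B1); split.
  - by apply: closedU => //; exact: closedI.
  - rewrite setUA -setIUr AB' -[in RHS]AB; congr (_ `|` _).
    by apply/setIidPl; rewrite -AB; exact: subsetUl.
  - rewrite setIUr (setIC A A') -setIA (setIA A A) setIid.
    by rewrite setICA AB0' setI0 -setIA AB0 setI0 setU0.
have Fdir : forall A A', F A -> F A' -> exists2 A'', F A'' & A'' `<=` A `&` A'.
  by move=> A A' FA FA'; exists (A `&` A') => //; exact: FI.
pose Q := \bigcap_(A in F) A.
have cQ : closed Q by apply: closed_bigI => A [].
have Qx : Q x by move=> A [].
have Qcon : connected Q.
  apply: closed_connectedP => // M N cM cN M0 N0 MNQ MN0.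
  wlog Mx : M N cM cN M0 N0 MNQ MN0 / M x.
    move=> h; have [Mx|Nx] : (M `|` N) x by rewrite MNQ.
    - exact: (h M N).
    - by apply: (h N M) => //; rewrite 1?setUC// setIC.
  have [U [V [oU oV MU NV UV0]]] := nT cM cN MN0.
  have [A [cA Ax [B1 [cB1 AB AB0]]] AUV] : exists2 A, F A & A `<=` U `|` V.
    apply: directed_compact => //; [by exists C|by move=> A []|exact: openU|].
    by rewrite -/Q -MNQ => y [/MU|/NV]; [left|right].
  (* Removing [V] from [A] leaves a clopen part around [x], which contradicts that [N] lies both in
     [V] and in every member of [F]. *)
  have FAV : F (A `\` V).
    split.
    - by apply: closedI => //; exact: open_closedC.
    - split=> // Vx; have : (U `&` V) x by split=> //; exact: MU.
      by rewrite UV0.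
    - exists ((A `\` U) `|` B1); split.
      + by apply: closedU => //; apply: closedI => //; exact: open_closedC.
      + rewrite setUA -AB -setDIr (setIC V U) UV0 setD0//.
      + apply/seteqP; split=> // y [[Ay nVy] [[_ nUy]|By]].
          by case: (AUV y Ay).
        by rewrite -AB0.
  case: N0 => n Nn; have : Q n by rewrite -MNQ; right.
  by move=> /(_ _ FAV) [_]; apply; exact: NV.
have QC : Q `<=` connected_component C x.
  by apply: connected_component_max => //; exact: (bigcap_inf FC).
have [D [cD Dx [D' [cD' DD' DD0]]] DB] : exists2 A, F A & A `<=` ~` B.
  apply: directed_compact => //; 
    [by exists C|by move=> A []|exact: closed_openC|].
  move=> y /QC Cy By; suff : set0 y by [].
  by rewrite -BC0.
exists D, D'; split=> //; split=> //.
by apply/seteqP; split=> // y [By /DB].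
Qed.

(** If the component missed the closure of [V], so would a clopen part [D] of [Y] minus [V] around
    [x], and [D] would be clopen in [Y]. *)
Lemma boundary_bumping (Y V : set T) x :
  closed Y -> connected Y -> Y x -> open V -> ~ V x -> (Y `&` V) !=set0 ->
  (closure V `&` connected_component (Y `\` V) x) !=set0.
Proof.
move=> cY Yc Yx oV nVx [v [Yv Vv]]; apply/set0P/eqP => h.
have cYV : closed (Y `\` V) by apply: closedI => //; exact: open_closedC.
have [D [D' [[cD cD' DD' DD0] [Dx VD0]]]] :=
  component_clopen cYV (@closed_closure _ V) (conj Yx nVx) h.
have [] := @connected_closed_split _ Y D (D' `|` closure V) Yc cD.
- by apply: closedU => //; exact: closed_closure.
- move=> y Yy; have [Vy|nVy] := pselect (V y).
    by right; right; exact: subset_closure.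
  have : (D `|` D') y by rewrite DD'.
  by case; [left|right; left].
- apply/seteqP; split=> // y [_ [Dy [D'y|Vy]]]; first by rewrite -DD0.
  by rewrite -VD0.
- move=> /(_ v Yv) Dv; suff : (Y `\` V) v by case.
  by rewrite -DD'; left.
- move=> /(_ x Yx) [D'x|Vx].
    suff : set0 x by []. by rewrite -DD0.
  suff : set0 x by []. by rewrite -VD0.
Qed.

(** When the closure splits into [P] and [Q], the unions of [L] with [P] and with [Q] serve: a piece
    of the first that misses [L] lies in [P], so it misses [Q] too and would be clopen in [Y]. *)
Lemma complement_split (Y L : set T) : closed Y -> connected Y -> closed L ->
  connected L -> L !=set0 -> L `<=` Y ->
  connected (closure (Y `\` L)) \/
  exists S S', [/\ closed S /\ connected S, closed S' /\ connected S',
    L `<=` S `&` S', S `<` Y /\ S' `<` Y & S `|` S' = Y].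
Proof.
move=> cY Yc cL Lc L0 LY.
have [?|nc] := pselect (connected (closure (Y `\` L))); [by left|right].
have [P [Q [cP cQ [P0 Q0] PQ PQ0]]] : exists P Q, [/\ closed P, closed Q,
    P !=set0 /\ Q !=set0, P `|` Q = closure (Y `\` L) & P `&` Q = set0].
  apply: contrapT => h; apply: nc; apply: closed_connectedP.
    exact: closed_closure.
  by move=> M N *; apply: h; exists M, N.
have clY : closure (Y `\` L) `<=` Y.
  rewrite [X in _ `<=` X](closure_id Y).1//; apply: closureS; exact: subDsetl.
have LPQ : L `|` (P `|` Q) = Y.
  rewrite PQ; apply/seteqP; split=> [y [/LY|/clY]//|y Yy].
  have [Ly|nLy] := pselect (L y); [by left|right].
  exact: subset_closure.
have con P1 Q1 : closed P1 -> closed Q1 -> P1 `|` Q1 = closure (Y `\` L) ->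
    P1 `&` Q1 = set0 -> connected (L `|` P1).
  move=> cP1 cQ1 PQ1 PQ10; apply: closed_connectedP; first exact: closedU.
  move=> M N cM cN M0 N0 MN MN0.
  wlog LM : M N cM cN M0 N0 MN MN0 / L `<=` M.
    move=> h; have [LM|LN] : L `<=` M \/ L `<=` N.
      apply: connected_closed_split => //; last by rewrite MN0 setI0.
      by rewrite MN; exact: subsetUl.
    - exact: (h M N).
    - by apply: (h N M) => //; rewrite 1?setUC// setIC.
  have [m Mm] := M0; have [n Nn] := N0; have [l Ll] := L0.
  have MNQ : M `|` N `|` Q1 = Y by rewrite MN -setUA PQ1 -PQ.
  have NP z : N z -> P1 z.
    move=> Nz; have : (L `|` P1) z by rewrite -MN; right.
    case=> // /LM Mz; suff : set0 z by [].
    by rewrite -MN0.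
  have [] := @connected_closed_split _ Y N (M `|` Q1) Yc cN.
  - exact: closedU.
  - by rewrite -MNQ => z [[]|]; [right; left|left|right; right].
  - apply/seteqP; split=> // z [_ [Nz [Mz|Qz]]]; first by rewrite -MN0.
    by rewrite -PQ10; split=> //; exact: NP.
  - move=> /(_ l (LY _ Ll)) Nl; suff : set0 l by [].
    by rewrite -MN0; split=> //; exact: LM.
  - have : Y n by rewrite -MNQ; left; right.
    move=> Yn /(_ n Yn) [Mn|Qn]; (suff : set0 n by []); first by rewrite -MN0.
    by rewrite -PQ10; split=> //; exact: NP.
have prop P1 Q1 : closed P1 -> closed Q1 -> Q1 !=set0 ->
    P1 `|` Q1 = closure (Y `\` L) -> P1 `&` Q1 = set0 -> L `|` P1 `<` Y.
  move=> cP1 cQ1 [q Qq] PQ1 PQ10; split.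
    by rewrite subUset; split=> // z Pz; apply: clY; rewrite -PQ1; left.
  move=> YLP; have : closure (Y `\` L) q by rewrite -PQ1; right.
  rewrite /closure/= => /(_ (~` P1)) [|z [[Yz nLz] nPz]].
    apply: open_nbhs_nbhs; split; first exact: closed_openC.
    move=> Pq; suff : set0 q by []. by rewrite -PQ10.
  by case: (YLP z Yz).
have PQ' : Q `|` P = closure (Y `\` L) by rewrite setUC.
have PQ0' : Q `&` P = set0 by rewrite setIC.
exists (L `|` P), (L `|` Q); split.
- by split; [exact: closedU|exact: (con P Q)].
- by split; [exact: closedU|exact: (con Q P)].
- by move=> z Lz; split; left.
- by split; [exact: (prop P Q)|exact: (prop Q P)].
- by rewrite -setUUr.
Qed.

End CompactNormal.

(** * Connected subsets of trees *)

Section AcyclicGraphs.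
Variables (n : nat) (e : rel 'I_n).
Hypotheses (e_sym : symmetric e) (e_irr : irreflexive e).
Hypothesis e_acyclic : forall c : seq 'I_n, ucycle e c -> (size c <= 2)%N.

(* [w] is the neighbour of the leaf [v], or any vertex, such as [v] itself, when
   [v] is isolated in [A]. *)
Lemma exists_leaf (A : {set 'I_n}) : A != finset.set0 ->
  exists v w, [/\ v \in A, w \in A & forall k, k \in A -> e v k -> k = w].
Proof.
case/set0Pn => a0 a0A; apply: contrapT => noleaf.
have next v w : v \in A -> w \in A -> exists k, [/\ k \in A, e v k & k != w].
  move=> vA wA; apply: contrapT => h; apply: noleaf; exists v, w.
    split=> // k kA evk.
  by apply/eqP/negPn/negP => kw; apply: h; exists k.
(* The path grows at its head [x], by a neighbour other than the second vertex. If that neighbour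
   were already on the path, it would close a cycle with at least three vertices. *)
have long m : exists x p, [/\ path e x p, uniq (x :: p),
    {subset x :: p <= A} & size p = m].
  elim: m => [|m [x [p [ep up pA sp]]]].
    by exists a0, [::]; split=> // y; rewrite inE => /eqP ->.
  have xA : x \in A by apply: pA; rewrite inE eqxx.
  have hA : head x p \in A.
    by case: p pA {ep up sp} => //= y p pA; apply: pA; rewrite !inE eqxx orbT.
  have [k [kA exk kh]] := next _ _ xA hA.
  have [kp|kp] := boolP (k \in x :: p); last first.
    exists k, (x :: p); split=> /=; rewrite ?sp//.
    - by rewrite e_sym exk.
    - by rewrite kp.
    - by move=> y; rewrite inE => /predU1P[->|/pA].
  move: kp; rewrite inE => /predU1P[kx|]; first by rewrite kx e_irr in exk.
  case: p ep up {pA sp hA} kh => //= y p /andP[exy ep] up ky.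
  rewrite inE (negbTE ky)/= => /path.splitPr kp; case: kp ep up => p1 p2.
  rewrite cat_path /= => /and3P[ep1 elk _].
  rewrite !inE !mem_cat !cat_uniq /= !inE !negb_or => H.
  suff : ucycle e (x :: y :: rcons p1 k).
    by move/e_acyclic; rewrite /= size_rcons.
  apply/andP; split => /=.
    by rewrite exy rcons_path rcons_path ep1 last_rcons /= elk e_sym.
  rewrite !inE !mem_rcons !inE !negb_or rcons_uniq.
  by case/and5P: H => /and4P[-> -> -> _] /andP[-> /andP[-> _]] -> /andP[-> _] _.
(* This path has [n.+1] distinct vertices, one more than ['I_n] offers. *)
have [x [p [_ up _ sp]]] := long n.
have := max_card (mem (x :: p)); rewrite (card_uniqP up) card_ord /= sp.
by rewrite ltnn.
Qed.

End AcyclicGraphs.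

Local Open Scope ring_scope.

Section RowVectors.
Context {R : realType} {n : nat}.

Lemma continuous_row (T : topologicalType) (f : T -> 'rV[R]_n) :
  (forall j, continuous (fun x => f x ord0 j)) -> continuous f.
Proof.
move=> cf x; apply/cvg_mx_entourageP => A entA.
have h j : \forall y \near x, (f x ord0 j, f y ord0 j) \in A.
  have := cf j x _ (nbhs_entourage _ entA).
  apply: (@filterS _ (nbhs x)) => y /= /xsectionP.
  by rewrite inE.
suff : nbhs x [set y | forall i j, (f x i j, f y i j) \in A] by [].
have H := @filter_forall _ _ _ _ (nbhs_filter x) h.
apply: (@filterS _ (nbhs x) _ _ _ _ H) => y hy i j.
by rewrite ord1; exact: hy.
Qed.

Lemma row_hausdorff : hausdorff_space 'rV[R]_n.
Proof.
move=> p q pq; apply/rowP => j; apply: (@norm_hausdorff _ R) => A B nA nB.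
have cj := @coord_continuous R 1 n ord0 j.
have [t [tA tB]] := pq _ _ (cj p _ nA) (cj q _ nB).
by exists (t ord0 j).
Qed.

End RowVectors.

(** * Realizations of acyclic graphs *)

Section TreeIntersections.
Context {R : realType} {n : nat}.
Variable e : rel 'I_n.
Hypotheses (e_sym : symmetric e) (e_irr : irreflexive e).
Hypothesis e_acyclic : forall c : seq 'I_n, ucycle e c -> (size c <= 2)%N.

(** The subgraph induced on [A], cut out by vanishing coordinates so that the induction on [A] stays
    in one ambient space. *)
Definition spanned (A : {set 'I_n}) : set 'rV[R]_n :=
  [set t | realization e t /\ forall k, k \notin A -> t ord0 k = 0].

Lemma sum_pair_rest (t : 'rV[R]_n) (v w : 'I_n) : v != w ->
  \sum_k t ord0 k = t ord0 v + t ord0 w +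
    \sum_(k | (k != v) && (k != w)) t ord0 k.
Proof.
by move=> vw; rewrite (bigD1 v)//= (bigD1 w) ?addrA//= eq_sym.
Qed.

(** For distinct [v] and [w] the parameter is the coordinate at [v]; for [v = w] the point is
    constantly that vertex. *)
Definition edge_point (v w : 'I_n) (s : R) : 'rV[R]_n :=
  s *: delta_mx ord0 v + (1 - s) *: delta_mx ord0 w.

Lemma edge_pointP (v w : 'I_n) (t : 'rV[R]_n) : \sum_k t ord0 k = 1 ->
  (forall k, k != v -> k != w -> t ord0 k = 0) ->
  t = edge_point v w (t ord0 v).
Proof.
move=> t1 t0; apply/rowP => k; rewrite !mxE eqxx /=.
have [vw|vw] := eqVneq v w.
  have tv : t ord0 v = 1.
    rewrite -t1 (bigD1 v)//= big1 ?addr0// => i iv.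
    by rewrite t0 // -vw.
  rewrite -vw -mulrDl addrC subrK mul1r.
  by have [->|kv] := eqVneq k v; rewrite ?tv// t0 // -vw.
have tw : t ord0 w = 1 - t ord0 v.
  rewrite -t1 (sum_pair_rest _ vw) big1 ?addr0; first by rewrite addrC addKr.
  by move=> i /andP[iv iw]; exact: t0.
have [->|kv] := eqVneq k v; first by rewrite (negbTE vw) mulr0 addr0 mulr1.
have [->|kw] := eqVneq k w; first by rewrite tw mulr0 mulr1 add0r.
by rewrite !mulr0 addr0 t0.
Qed.

Lemma edge_point_continuous v w : continuous (edge_point v w).
Proof.
apply: continuous_row => j; rewrite /edge_point.
rewrite [X in continuous X](_ : _ = fun s : R =>
  s * (delta_mx ord0 v : 'rV[R]_n) ord0 j
  + (1 - s) * (delta_mx ord0 w : 'rV[R]_n) ord0 j); last first.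
  by apply/funext => s; rewrite !mxE.
move=> s; apply: cvgD; apply: cvgMl; first exact: cvg_id.
by apply: cvgB; [exact: cvg_cst|exact: cvg_id].
Qed.

(** The map moves the weight at [v] over to [w]; when [v] is a leaf attached to [w], it collapses
    that edge to [w] and fixes the rest. *)
Lemma leaf_retract_continuous v w : continuous
  (fun t : 'rV[R]_n => t + t ord0 v *: (delta_mx ord0 w - delta_mx ord0 v)).
Proof.
apply: continuous_row => j.
rewrite [X in continuous X](_ : _ = fun t : 'rV[R]_n => t ord0 j +
   t ord0 v * (delta_mx ord0 w - delta_mx ord0 v : 'rV[R]_n) ord0 j); last first.
  by apply/funext => t; rewrite !mxE.
move=> t; apply: (@cvgD _ _ _ _ (nbhs_filter t)); first exact: coord_continuous.
by apply: (@cvgMr_tmp _ _ _ (nbhs_filter t)); exact: coord_continuous.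
Qed.

(** Induction on the number of vertices, cutting at the neighbour [w] of a leaf [v]. The
    intersection is connected off the leaf edge by induction and on the edge by intervals; if both
    parts are nonempty, [S] and [S'] both contain [w], which joins them. *)
Lemma spanned_connectedI (A : {set 'I_n}) (S S' : set 'rV[R]_n) :
  S `<=` spanned A -> S' `<=` spanned A -> connected S -> connected S' ->
  connected (S `&` S').
Proof.
have [m] := ubnP #|A|; elim: m A S S' => // m IH A S S' Am SA S'A cS cS'.
have [A0|/(exists_leaf e_sym e_irr e_acyclic)] := eqVneq A finset.set0.
  suff -> : S = set0 by rewrite set0I; exact: connected0.
  rewrite -subset0 => t /SA[[_ t1 _] t0].
  move: t1; rewrite big1; last by move=> k _; rewrite t0// A0 inE.
  by move/eqP; rewrite eq_sym oner_eq0.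
move=> [v [w [vA wA leaf]]].
(* On [spanned A], [M] removes the leaf [v] and [N] is the edge from [v] to [w];
   they meet at most in the vertex [w]. *)
pose M := [set t : 'rV[R]_n | t ord0 v <= 0].
pose N := [set t : 'rV[R]_n | 1 <= t ord0 v + t ord0 w].
have cM : closed M.
  apply: (@closed_comp _ _ (fun t : 'rV[R]_n => t ord0 v) [set x | x <= 0]).
    by move=> t _; exact: coord_continuous.
  exact: closed_le.
have cN : closed N.
  apply: (@closed_comp _ _ (fun t : 'rV[R]_n => t ord0 v + t ord0 w)
    [set x | 1 <= x]); last exact: closed_ge.
  by move=> t _; apply: (@cvgD _ _ _ _ (nbhs_filter t)); exact: coord_continuous.
have Mv t : spanned A t -> M t -> t ord0 v = 0.
  by move=> [[t0 _ _] _] tM; apply/eqP; rewrite eq_le tM t0.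
(* A point with weight at [v] is [v] itself or lies on an edge at [v], whose other end can only be
   [w]. *)
have supp t : spanned A t -> t ord0 v != 0 ->
    forall k, k != v -> k != w -> t ord0 k = 0.
  move=> [[t0 t1 [i [j [ij tij]]]] tA] tv k kv kw.
  apply/eqP/negPn/negP => tk.
  have kA : k \in A by apply/negPn/negP => /tA/eqP; rewrite (negbTE tk).
  suff /(leaf _ kA)/eqP : e v k by rewrite (negbTE kw).
  have := tij _ tv; have := tij _ tk.
  case: ij => [<-|eij]; first by move=> [] kE [] vE; rewrite kE vE eqxx in kv.
  move=> [] kE [] vE; try by rewrite kE vE eqxx in kv.
    by rewrite kE vE e_sym.
  by rewrite kE vE.
have MN t : spanned A t -> (M `|` N) t.
  move=> At; have [tv|tv] := eqVneq (t ord0 v) 0; first by left; rewrite /M/= tv.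
  right; have [[t0 t1 _] _] := At.
  have := edge_pointP t1 (supp _ At tv) => tE; rewrite /N/=.
  rewrite [in leRHS]tE !mxE !eqxx /=.
  by have [_|_] := eqVneq v w; rewrite !(mulr0, mulr1) /=; lra.
have NE t : spanned A t -> N t -> t = edge_point v w (t ord0 v).
  move=> At tN; have [[t0 t1 _] _] := At; apply: edge_pointP => //.
  have [tv|tv] := eqVneq (t ord0 v) 0; last exact: supp.
  move=> k kv kw; have vw : v != w.
    by apply/eqP => vw; move: tN; rewrite /N/= -vw tv addr0 ler10.
  have := t1; rewrite (sum_pair_rest _ vw) (bigD1 k) ?kv//=.
  set s := \sum_(_ | _) _; have s0 : 0 <= s by apply: sumr_ge0.
  move: tN (t0 k); rewrite /N/= tv; lra.
have MNE t : spanned A t -> M t -> N t -> v != w /\ t = delta_mx ord0 w.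
  move=> At tM tN; have tv := Mv _ At tM; split.
    by apply/eqP => vw; move: tN; rewrite /N/= -vw tv addr0 ler10.
  by rewrite (NE _ At tN) tv /edge_point scale0r add0r subr0 scale1r.
(* Either [B] lies on one side, or it contains [w]. In the latter case its part in [M] is its image
   under the leaf retraction, and its part in [N] is the image of its [v]-coordinates under
   [edge_point]. *)
have piece (B : set 'rV[R]_n) : B `<=` spanned A -> connected B ->
    [/\ connected (B `&` M), connected (B `&` N) &
     B `&` M !=set0 -> B `&` N !=set0 ->
       (B `&` (M `&` N)) (delta_mx ord0 w) ].
  move=> BA cB.
  have [h|/set0P[t [Bt [tM tN]]]] := eqVneq (B `&` (M `&` N)) set0.
    have [BM|BN] := connected_closed_split cB cM cN 
      (fun t Bt => MN t (BA t Bt)) h.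
      rewrite (setIidl BM) (_ : B `&` N = set0); last first.
        apply/seteqP; split=> // t [Bt tN]; rewrite -h; split=> //.
        by split=> //; exact: BM.
      by split=> //; [exact: connected0|move=> _ []].
    rewrite (setIidl BN) (_ : B `&` M = set0); last first.
      apply/seteqP; split=> // t [Bt tM]; rewrite -h; split=> //.
      by split=> //; exact: BN.
    by split=> //; [exact: connected0|move=> []].
  have [vw tw] := MNE _ (BA _ Bt) tM tN; rewrite tw in Bt tM tN; split=> //.
  - rewrite (_ : _ `&` _ = (fun t : 'rV[R]_n =>
        t + t ord0 v *: (delta_mx ord0 w - delta_mx ord0 v)) @` B).
      apply: connected_continuous_connected => //.
      by apply: continuous_subspaceT; exact: leaf_retract_continuous.
    apply/seteqP; split=> [u [Bu uM]|_ [u Bu <-]].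
      by exists u => //; rewrite (Mv _ (BA _ Bu) uM) scale0r addr0.
    have [uv|uv] := eqVneq (u ord0 v) 0.
      by rewrite uv scale0r addr0; split=> //; rewrite /M/= uv.
    suff -> : u + u ord0 v *: (delta_mx ord0 w - delta_mx ord0 v) = delta_mx ord0 w.
      by split=> //; rewrite -tw.
    have [[_ u1 _] _] := BA _ Bu.
    rewrite {1}(edge_pointP u1 (supp _ (BA _ Bu) uv)) /edge_point.
    by apply/rowP => k; rewrite !mxE; ring.
  - rewrite (_ : _ `&` _ = edge_point v w @` ((fun t : 'rV[R]_n => t ord0 v) @` B)).
      apply: connected_continuous_connected.
        apply: connected_continuous_connected => //.
        by apply: continuous_subspaceT; exact: coord_continuous.
      by apply: continuous_subspaceT; exact: edge_point_continuous.
    apply/seteqP; split=> [u [Bu uN]|_ [_ [u Bu <-] <-]].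
      by exists (u ord0 v); [exists u|rewrite -NE//; exact: BA].
    have [uv|uv] := eqVneq (u ord0 v) 0.
      by rewrite uv /edge_point scale0r add0r subr0 scale1r -tw; split=> //; rewrite tw.
    have [[_ u1 _] _] := BA _ Bu.
    have uE := edge_pointP u1 (supp _ (BA _ Bu) uv).
    rewrite -uE; split=> //; case: (MN _ (BA _ Bu)) => // uM.
    by move: uv; rewrite Mv ?eqxx//; exact: BA.
have [cSM cSN Sw] := piece _ SA cS.
have [cS'M cS'N S'w] := piece _ S'A cS'.
have cIM : connected ((S `&` M) `&` (S' `&` M)).
  apply: (IH (A :\ v)%SET) => //.
  - by move: Am; rewrite (cardsD1 v A) vA.
  - move=> t [St tM]; have At := SA _ St; split; first by case: At.
    move=> k; rewrite !inE negb_and negbK => /orP[/eqP ->|kA].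
      exact: Mv.
    by case: At => _; exact.
  - move=> t [St tM]; have At := S'A _ St; split; first by case: At.
    move=> k; rewrite !inE negb_and negbK => /orP[/eqP ->|kA].
      exact: Mv.
    by case: At => _; exact.
have cIN : connected ((S `&` N) `&` (S' `&` N)).
  (* On [N] the coordinate at [v] determines the point, so the intersection is the image of an
     intersection of two intervals. *)
  pose c := fun t : 'rV[R]_n => t ord0 v.
  rewrite (_ : _ `&` _ = edge_point v w @` (c @` (S `&` N) `&` c @` (S' `&` N))).
    apply: connected_continuous_connected; last first.
      by apply: continuous_subspaceT; exact: edge_point_continuous.
    have ic B : connected B -> is_interval (c @` B).
      move=> cB; apply/connected_intervalP.
      apply: connected_continuous_connected => //.
      by apply: continuous_subspaceT; exact: coord_continuous.
    apply/connected_intervalP => x y [x1 x2] [y1 y2] z xzy.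
    by split; [exact: (ic _ cSN x y)|exact: (ic _ cS'N x y)].
  apply/seteqP; split=> [t [[St tN] [S't _]]|].
    exists (c t); last by rewrite -NE//; exact: SA.
    by split; exists t.
  move=> _ [s [[t [St tN] <-] [t' [S't tN'] tt']] <-].
  have <- := NE _ (SA _ St) tN; split=> //.
  have -> : t = t'; last by [].
  by rewrite (NE _ (SA _ St) tN) (NE _ (S'A _ S't) tN') -/(c t) -tt'.
have -> : S `&` S' = ((S `&` M) `&` (S' `&` M)) `|` ((S `&` N) `&` (S' `&` N)).
  apply/seteqP; split=> [t [St S't]|t [] [[? ?] [? ?]]//].
  by case: (MN _ (SA _ St)); [left|right].
have [->|/set0P[a [[Sa aM] [S'a _]]]] := eqVneq ((S `&` M) `&` (S' `&` M)) set0.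
  by rewrite set0U.
have [->|/set0P[b [[Sb bM] [S'b _]]]] := eqVneq ((S `&` N) `&` (S' `&` N)) set0.
  by rewrite setU0.
apply: connectedU => //.
have [wS [wM wN]] : (S `&` (M `&` N)) (delta_mx ord0 w).
  by apply: Sw; [exists a|exists b].
have [wS' _] : (S' `&` (M `&` N)) (delta_mx ord0 w).
  by apply: S'w; [exists a|exists b].
by exists (delta_mx ord0 w).
Qed.

Lemma realization_connectedI (S S' : set 'rV[R]_n) :
  S `<=` realization e -> S' `<=` realization e ->
  connected S -> connected S' -> connected (S `&` S').
Proof.
by move=> SA S'A; apply: (@spanned_connectedI finset.setT) => t /[dup] h;
  [move/SA|move/S'A]; split=> // k; rewrite inE.
Qed.

End TreeIntersections.

(** * Intersections of subcontinua of a tree-like continuum *)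

Section TreeLike.
Context {R : realType} {X : metricType R}.
Implicit Types A B K L : set X.

Lemma metric_normal A B : closed A -> closed B -> A `&` B = set0 ->
  exists U V, [/\ open U, open V, A `<=` U, B `<=` V & U `&` V = set0].
Proof. by move: A B; apply/(@normal_openP R); exact: pseudometric_normal. Qed.

Lemma closed_set1 (x : X) : closed [set x].
Proof.
by apply: accessible_closed_set1; exact/hausdorff_accessible/metric_hausdorff.
Qed.

(** The closures of the sets of points of [A] closer than [r] to [B] shrink to a subset of [A] and
    [B], so by compactness one of them is empty. *)
Lemma disjoint_closed_dist A B : compact [set: X] -> closed A -> closed B ->
  A `&` B = set0 ->
  exists2 eps : R, 0 < eps & forall x y, A x -> B y -> eps <= mdist x y.
Proof.
move=> cX cA cB AB0; pose near_B (r : R) := [set x | A x /\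
  exists2 y, B y & mdist x y < r].
pose F := [set C | exists2 r : R, 0 < r & C = closure (near_B r)].
have [] := @directed_compact X F set0 cX.
- by exists (closure (near_B 1)), 1.
- by move=> _ [r _ ->]; exact: closed_closure.
- move=> _ _ [r r0 ->] [s s0 ->]; exists (closure (near_B (Num.min r s))).
    by exists (Num.min r s) => //; rewrite lt_min r0.
  rewrite subsetI; split; apply: closureS => x [Ax [y By]];
    by rewrite lt_min => /andP[? ?]; split=> //; exists y.
- exact: open0.
- move=> x Fx; rewrite -AB0; split.
    apply: cA; apply: (closureS _ (Fx (closure (near_B 1)) _)); last by exists 1.
    by move=> y [].
  apply: cB => U /nbhs_ballP[r /= r0 rU].
  have r2 : 0 < r / 2 by rewrite divr_gt0.
  have /(_ (ball x (r / 2)) (nbhsx_ballx _ _ r2)) :=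
    Fx _ (ex_intro2 _ _ (r / 2) r2 erefl).
  move=> [z [[_ [y By zy]] xz]]; exists y; split=> //; apply: rU.
  rewrite [r]splitr; apply: (@ball_triangle _ _ z) => //.
  by rewrite ballEmdist.
- move=> _ [r r0 ->] h; exists r => // x y Ax By.
  rewrite leNgt; apply/negP => xy; apply: (h x).
  by apply: subset_closure; split=> //; exists y.
Qed.

Lemma diam_lt A (eps : R) x y : (diam A < eps%:E)%E -> A x -> A y ->
  mdist x y < eps.
Proof.
move=> dA Ax Ay; rewrite -lte_fin; apply: le_lt_trans dA.
by apply: ereal_sup_ubound; right; exists (x, y).
Qed.

Lemma tree_like_map (eps : R) : tree_like_continuum X -> 0 < eps ->
  exists n (e : rel 'I_n) (h : X -> 'rV[R]_n), [/\ tree_graph e, continuous h,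
    forall x, realization e (h x) & forall x y, h x = h y -> mdist x y < eps].
Proof.
move=> [_ tX] /tX[T [f [[n [e [te [g [g' [cg _ gK _]]]]]] cf df]]].
exists n, e, (fun x => set_val (g (f x))); split=> //.
- have cv : continuous (set_val : set_type (@realization R n e) -> 'rV[R]_n).
    exact: initial_continuous.
  move=> x; apply: (@continuous_comp _ _ _ (g \o f) set_val); last exact: cv.
  by apply: continuous_comp; [exact: cf|exact: cg].
- by move=> x; exact: set_valP.
- move=> x y hxy; apply: (diam_lt (df (f x))) => //=.
  apply: (can_inj gK); exact/esym/val_inj.
Qed.

(** If the intersection split into [P] and [Q], a map [h] to a tree with small fibers would keep the
    images of closed neighbourhoods [FP] and [FQ] disjoint. Yet within [K] these cover the
    intersection of the images of [K] and [L], which is connected and meets both. *)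
Lemma tree_like_connectedI K L : tree_like_continuum X ->
  closed K -> closed L -> connected K -> connected L -> connected (K `&` L).
Proof.
move=> tX cK cL Kc Lc; have [[_ cX _] _] := tX.
apply: closed_connectedP; first exact: closedI.
move=> P Q cP cQ [p Pp] [q Qq] PQ PQ0.
have [U [V [oU oV PU QV UV0]]] := metric_normal cP cQ PQ0.
have shrink A O : closed A -> open O -> A `<=` O ->
    exists A1 A2, [/\ open A1, closed A2, A `<=` A1, A1 `<=` A2 & A2 `<=` O].
  move=> cA oO AO.
  have [||A1 [B1 [oA1 oB1 AA1 OB1 AB0]]] := @metric_normal A (~` O) cA.
  - exact: open_closedC.
  - by apply/seteqP; split=> // x [/AO].
  exists A1, (~` B1); split=> //; first exact: open_closedC.
  - by move=> x Ax Bx; rewrite -[False]/(set0 x) -AB0.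
  - by move=> x nBx; apply: contrapT => /OB1.
have [U1 [FP [oU1 cFP PU1 U1F FPU]]] := shrink _ _ cP oU PU.
have [V1 [FQ [oV1 cFQ QV1 V1F FQV]]] := shrink _ _ cQ oV QV.
(* A fiber of diameter below [e1] that meets [L] can meet [K] only inside [U1] or [V1]. *)
have [||e1 e10 he1] := @disjoint_closed_dist (K `\` (U1 `|` V1)) L cX _ cL.
- by apply: closedI => //; apply: open_closedC; exact: openU.
- apply/seteqP; split=> // x [[Kx nUV] Lx]; apply: nUV.
  have : (P `|` Q) x by rewrite PQ.
  by move=> [/PU1|/QV1]; [left|right].
(* A fiber of diameter below [e2] cannot meet both [FP] and [FQ]. *)
have [|e2 e20 he2] := @disjoint_closed_dist FP FQ cX cFP cFQ.
  by apply/seteqP; split=> // x [/FPU Ux /FQV Vx]; rewrite -UV0.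
have eps0 : 0 < Num.min e1 e2 by rewrite lt_min e10.
have [n [e [h [[_ e_sym e_irr _ e_ac] ch hr hd]]]] := tree_like_map tX eps0.
have hd1 x y : h x = h y -> ~ (K `\` (U1 `|` V1)) x \/ ~ L y.
  move=> /hd; rewrite lt_min => /andP[xy _]; apply/not_andP => -[Kx Ly].
  by have := he1 _ _ Kx Ly; rewrite leNgt xy.
have hd2 x y : h x = h y -> FP x -> FQ y -> False.
  move=> /hd; rewrite lt_min => /andP[_ xy] Px Qy.
  by have := he2 _ _ Px Qy; rewrite leNgt xy.
have chA A : closed A -> closed (h @` A).
  move=> cA; apply: compact_closed; first exact: row_hausdorff.
  apply: continuous_compact; first exact: continuous_subspaceT.
  by apply: (subclosed_compact cA cX).
have hcon A : connected A -> connected (h @` A).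
  by move=> Ac; apply: connected_continuous_connected => //;
    exact: continuous_subspaceT.
have S_con : connected ((h @` K) `&` (h @` L)).
  by apply: (realization_connectedI e_sym e_irr e_ac);
    [move=> _ [x _ <-]|move=> _ [x _ <-]|exact: hcon|exact: hcon].
have PKL x : P x -> (K `&` L) x by rewrite -PQ; left.
have QKL x : Q x -> (K `&` L) x by rewrite -PQ; right.
have [] := connected_closed_split S_con
  (chA _ (closedI cK cFP)) (chA _ (closedI cK cFQ)).
- move=> _ [[k Kk <-] [l Ll lk]].
  have [h1|//] := hd1 _ _ (esym lk).
  have : (U1 `|` V1) k by apply: contrapT => nUV; exact: h1.
  by move=> [/U1F|/V1F] ?; [left|right]; exists k.
- apply/seteqP; split=> // t [_ [[x [_ Px] <-] [y [_ Qy] /esym xy]]].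
  exact: (hd2 _ _ xy).
- have [Kq Lq] := QKL _ Qq.
  move=> /(_ (h q)) [|x [_ Px] xq]; first by split; exists q.
  exact: (hd2 _ _ xq Px (V1F _ (QV1 _ Qq))).
- have [Kp Lp] := PKL _ Pp.
  move=> /(_ (h p)) [|x [_ Qx] xp]; first by split; exists p.
  exact: (hd2 _ _ (esym xp) (U1F _ (PU1 _ Pp)) Qx).
Qed.

End TreeLike.

(** * Families of pairwise unlinked points *)

Section Continua.
Context {R : realType} {X : metricType R}.
Hypothesis cX : compact [set: X].
Implicit Types A K L O S Y : set X.

Definition subcontinuum A := closed A /\ connected A.

(** This is membership of [y] in the meager composant of [x]: for closed [L], nowhere dense means
    empty interior. *)
Definition linked (x y : X) :=
  exists L, [/\ subcontinuum L, interior L = set0, L x & L y].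

Definition indecomposable Y := forall S S', subcontinuum S -> subcontinuum S' ->
  S `|` S' = Y -> S = Y \/ S' = Y.

Definition hull S := \bigcap_(L in [set L | subcontinuum L /\ S `<=` L]) L.

Lemma sub_hull S : S `<=` hull S.
Proof. by move=> x Sx L [_]; exact. Qed.

Lemma hull_sub S L : subcontinuum L -> S `<=` L -> hull S `<=` L.
Proof. by move=> sL SL; apply: bigcap_inf. Qed.

Lemma in_interior O A x : open O -> O `<=` A -> O x -> interior A x.
Proof. by move=> oO; rewrite open_subsetE// => OA /OA. Qed.

Lemma closed_shrink (x : X) O : open O -> O x ->
  exists F, [/\ closed F, F `<=` O & interior F x].
Proof.
move=> oO Ox; have c1 := @closed_set1 _ _ x.
have [||U [V [oU oV xU OV UV0]]] := @metric_normal _ _ [set x] (~` O) c1.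
- exact: open_closedC.
- by apply/seteqP; split=> // y [->].
exists (~` V); split; first exact: open_closedC.
  by move=> y nVy; apply: contrapT => /OV.
apply: (in_interior oU); last exact: xU.
by move=> y Uy Vy; rewrite -[False]/(set0 y) -UV0.
Qed.

Lemma countable_base : exists U : nat -> set X, (forall m, open (U m)) /\
  forall O x, open O -> O x -> exists m, U m x /\ U m `<=` O.
Proof.
have [[x0 _]|X0] := pselect (exists x : X, True); last first.
  by exists (fun=> set0); split=> [m|O x]; [exact: open0|case: X0; exists x].
pose pX : pseudoPMetricType R := HB.pack X (isPointed.Build X x0).
have [B cB [oB bB]] := @compact_second_countable R pX cX.
have /countable_injP[i iB] := cB.
(* The set numbered [m] is the basic set with code [m], or empty when [m] is no code. *)
exists (fun m => [set x | exists V, [/\ B V, i V = m & V x]]).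
split=> [m|O x oO Ox].
  rewrite (_ : mkset _ = \bigcup_(O in [set O | B O /\ i O = m]) O).
    by apply: bigcup_open => O [BO _]; exact: oB.
  by apply/seteqP; split=> [x [V [BV iV Vx]]|x [V [BV iV] Vx]]; exists V.
have [V [BV Vx] VO] := bB x O (open_nbhs_nbhs (conj oO Ox)).
exists (i V); split=> [|y [V' [BV' iV V'y]]]; first by exists V.
apply: VO; suff <- : V' = V by [].
by apply: iB iV; rewrite inE.
Qed.

Lemma nested_compact (F : nat -> set X) :
  (forall n, closed (F n)) -> (forall n, F n !=set0) ->
  (forall n, F n.+1 `<=` F n) -> exists x, forall n, F n x.
Proof.
move=> cF F0 dF; apply: contrapT => h.
have dFn m n : (m <= n)%N -> F n `<=` F m.
  move=> /subnK <-; elim: (n - m)%N => // k IH.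
  by rewrite addSn; apply: subset_trans (dF _) IH.
suff [_ [n _ <-] Fn0] : exists2 A, range F A & A `<=` set0.
  by have [x /Fn0] := F0 n.
apply: directed_compact => //.
- by exists (F 0%N), 0%N.
- by move=> _ [n _ <-].
- move=> _ _ [m _ <-] [n _ <-]; exists (F (maxn m n)); first by exists (maxn m n).
  by rewrite subsetI; split; apply: dFn; rewrite ?leq_maxl ?leq_maxr.
- exact: open0.
- by move=> x Fx; apply: h; exists x => n; apply: Fx; exists n.
Qed.

(** * Mycielski's Cantor scheme *)

Section Mycielski.
Variables (B : set (set X)) (E : nat -> X -> X -> Prop).
Hypothesis B_closed : forall F, B F -> closed F /\ F !=set0.
Hypothesis B_split : forall n F G, B F -> B G -> exists F' G',
  [/\ B F', B G', F' `<=` F, G' `<=` G & forall x y, F' x -> G' y -> ~ E n x y].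

(** The pairs are treated one at a time; sets only shrink, so separations achieved earlier
    persist. *)
Lemma refine_family (I : eqType) (ps : seq (nat * (I * I))) (V : I -> set X) :
  (forall i, B (V i)) -> exists V', (forall i, B (V' i) /\ V' i `<=` V i) /\
    forall p, p \in ps -> p.2.1 != p.2.2 ->
      forall x y, V' p.2.1 x -> V' p.2.2 y -> ~ E p.1 x y.
Proof.
move=> BV; elim: ps => [|[k [s t]] ps [V' [BV' sep]]].
  by exists V; split=> // i; split.
have [st|st] := eqVneq s t.
  exists V'; split=> // p; rewrite inE => /predU1P[-> /=|]; last exact: sep.
  by rewrite st eqxx.
have [F' [G' [BF BG FV GV FG]]] := B_split k (BV' s).1 (BV' t).1.
pose V'' i := if i == s then F' else if i == t then G' else V' i.
have V''V' i : V'' i `<=` V' i.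
  by rewrite /V''; case: eqVneq => [->//|_]; case: eqVneq => [->//|_ x].
exists V''; split=> [i|p].
  split; last by apply: subset_trans (V''V' i) _; case: (BV' i).
  by rewrite /V''; case: eqVneq => // _; case: eqVneq => // _; case: (BV' i).
rewrite inE => /predU1P[-> /= _ x y|pps pst x y].
  by rewrite /V'' eqxx [t == s]eq_sym (negbTE st) eqxx; exact: FG.
by move=> /V''V' ? /V''V'; exact: sep.
Qed.

(** Level [n] attaches a member of [B] to each word of length [n]; different words of length [n.+1]
    are separated for [E 0] up to [E n]. Then [f] picks a point on each branch. *)
Lemma mycielski F0 : B F0 -> exists f : (nat -> bool) -> X,
  (forall u, F0 (f u)) /\
  forall u v, u <> v -> forall k, ~ E k (f u) (f v).
Proof.
move=> BF0.
have step (q : nat * (seq bool -> set X)) : exists V' : seq bool -> set X,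
    (forall s, B (q.2 s)) -> [/\ forall s, B (V' s),
      forall s, V' s `<=` q.2 (take q.1 s) &
      forall k s t, (k <= q.1)%N -> size s = q.1.+1 -> size t = q.1.+1 ->
        s != t -> forall x y, V' s x -> V' t y -> ~ E k x y].
  case: q => n V /=; have [BV|nBV] := pselect (forall s, B (V s)); last by exists V.
  pose words := [seq tval s | s <- enum {: n.+1.-tuple bool}].
  pose ps := [seq (k, q) | k <- iota 0 n.+1,
    q <- [seq (s, t) | s <- words, t <- words]].
  have [V' [BV' sep]] := refine_family ps (fun s => BV (take n s)).
  exists V' => _; split=> [s|s|k s t kn sn tn st].
  - by case: (BV' s).
  - by case: (BV' s).
  have word r : size r = n.+1 -> r \in words.
    move=> rn; apply/mapP; exists (tcast rn (in_tuple r)); last by rewrite val_tcast.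
    by rewrite mem_enum.
  apply: (sep (k, (s, t))) => //; apply: allpairs_f.
    by rewrite mem_iota.
  by apply: allpairs_f; exact: word.
have [nxt nxtP] := choice step.
pose W := fix W n := if n is m.+1 then nxt (m, W m) else fun=> F0.
have BW n s : B (W n s).
  elim: n s => [//|n IH] s.
  by have [h _ _] := nxtP (n, W n) IH; exact: h.
pose path u n := W n (mkseq u n).
have pathS u n : path u n.+1 `<=` path u n.
  have [_ /(_ (mkseq u n.+1)) + _] := nxtP (n, W n) (BW n).
  by rewrite /= /path {2}/mkseq -map_take take_iota (minn_idPl (leqnSn n)).
have pt u : exists x, forall n, path u n x.
  by apply: nested_compact => // n; case: (B_closed (BW n (mkseq u n))).
have [f fP] := choice pt; exists f; split=> [u|u v uv k].
  exact: (fP u 0%N).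
have [i uvi] : exists i, u i <> v i.
  by apply: contrapT => h; apply: uv; apply/funext => i; apply: contrapT => ?;
    apply: h; exists i.
(* With [k <= n] level [n.+1] treats [E k], and with [i <= n] the prefixes of length [n.+1]
   differ. *)
pose n := maxn k i.
have [_ _ sep] := nxtP (n, W n) (BW n).
apply: (sep k (mkseq u n.+1) (mkseq v n.+1)); rewrite ?size_mkseq ?leq_maxl//.
- apply/eqP => /(congr1 (fun s => nth false s i)).
  by rewrite !nth_mkseq ?ltnS ?leq_maxr.
- exact: (fP u n.+1).
- exact: (fP v n.+1).
Qed.

End Mycielski.

(** * Hulls and indecomposable subcontinua *)

Hypothesis conX : connected [set: X].
Hypothesis subcontinuum_connectedI : forall K L,
  subcontinuum K -> subcontinuum L -> connected (K `&` L).

Let nX := @metric_normal R X.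

Lemma subcontinuumI K L :
  subcontinuum K -> subcontinuum L -> subcontinuum (K `&` L).
Proof.
move=> sK sL; split; last exact: subcontinuum_connectedI.
by apply: closedI; [case: sK|case: sL].
Qed.

Lemma subcontinuumU K L : K `&` L !=set0 ->
  subcontinuum K -> subcontinuum L -> subcontinuum (K `|` L).
Proof. by move=> KL [? ?] [? ?]; split; [exact: closedU|exact: connectedU]. Qed.

(** The continua containing [S] are closed under intersection, hence directed, and the whole space
    is one of them. *)
Lemma hull_subcontinuum S : subcontinuum (hull S).
Proof.
split; first by apply: closed_bigI => L [[]].
apply: (directed_connected cX nX) => [|L [sL _]//|K L [sK SK] [sL SL]].
  by exists setT; do 2 split=> //; exact: closedT.
exists (K `&` L) => //; split; first exact: subcontinuumI.
by rewrite subsetI.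
Qed.

Lemma component_subcontinuum A x :
  closed A -> subcontinuum (connected_component A x).
Proof. by move=> cA; split; [exact: component_closed|exact: component_connected]. Qed.

(** By [complement_split] and indecomposability the closure of [Y] minus [L] is a continuum.
    Together with [L] it makes up [Y], so it is [Y], and [L] has no interior. *)
Lemma indecomposable_interior Y L : subcontinuum Y -> indecomposable Y ->
  subcontinuum L -> L `<=` Y -> L <> Y -> interior L = set0.
Proof.
move=> [cY Yc] iY [cL Lc] LY LnY; rewrite -subset0 => v Lv.
have [||[S [S' [sS sS' _ [[_ SY] [_ S'Y]] SSY]]]] :=
  complement_split cY Yc cL Lc _ LY.
- by exists v; exact: interior_subset.
- move=> cYL; have sYL : subcontinuum (closure (Y `\` L)).
    by split=> //; exact: closed_closure.
  have [|//|YL] := iY _ _ (conj cL Lc) sYL.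
    apply/seteqP; split=> y.
      move=> [/LY//|]; have /closure_id cYE := cY; rewrite [X in _ -> X y]cYE.
      by apply: closureS; exact: subDsetl.
    move=> Yy; have [Ly|nLy] := pselect (L y); [by left|right].
    exact: subset_closure.
  have : closure (Y `\` L) v by rewrite YL; apply: LY; exact: interior_subset.
  by move=> cl; have [y [[_ nLy] Ly]] := cl _ Lv.
- by case: (iY _ _ sS sS' SSY) => E; [apply: SY|apply: S'Y] => z; rewrite E.
Qed.

Lemma indecomposable_unlinked Y : subcontinuum Y -> indecomposable Y ->
  interior Y !=set0 ->
  exists f : (nat -> bool) -> X, forall u v, u <> v -> ~ linked (f u) (f v).
Proof.
move=> sY iY Y0.
have [U [oU Ubase]] := countable_base.
have UP O : open O -> O !=set0 -> exists m, U m !=set0 /\ U m `<=` O.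
  move=> oO [x Ox]; have [m [Ux UO]] := Ubase O x oO Ox.
  by exists m; split=> //; exists x.
(* Each proper subcontinuum of [Y] that misses part of the interior of [Y] avoids some basic [U m]
   inside [Y], so countably many relations suffice. *)
pose E m x y := [/\ U m !=set0, U m `<=` Y &
  exists L, [/\ subcontinuum L, L `<=` Y `\` U m, L x & L y]].
pose B := [set F | [/\ closed F, F `<=` Y & interior F !=set0]].
have shrinkB F O x : B F -> open O -> O x -> interior F x ->
    exists F', [/\ B F', F' `<=` F & F' `<=` O].
  move=> [cF FY _] oO Ox Fx.
  have [F' [cF' F'O F'x]] := @closed_shrink x (O `&` interior F)
    (openI oO (@open_interior _ F)) (conj Ox Fx).
  have F'F : F' `<=` F by move=> y /F'O[_ /interior_subset].
  exists F'; split=> //; last by move=> y /F'O[].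
  by split=> //; [exact: subset_trans FY|exists x].
have [F|m F G BF BG||f [fY fE]] := @mycielski B E _ _ Y.
- by move=> [cF _ [x /interior_subset Fx]]; split=> //; exists x.
- have [[U0 UY]|nU] := pselect (U m !=set0 /\ U m `<=` Y); last first.
    by exists F, G; split=> // x y _ _ [U0 UY _]; apply: nU.
  have [_ FY [x Fx]] := BF; have [_ GY [y0 Gy0]] := BG.
  (* If [x] is in [U m], shrinking [F] into [U m] is enough. Otherwise the component of [x] in [Y]
     minus [U m] has empty interior, and some [y] in the interior of [G] is cut off from [x] by a
     clopen splitting. *)
  have [Ux|nUx] := pselect (U m x).
    have [F' [BF' F'F F'U]] := shrinkB _ _ _ BF (oU m) Ux Fx.
    by exists F', G; split=> // x' y' /F'U Ux' _ [_ _ [L [_ LU /LU[_]]]].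
  have Yx : Y x by apply: FY; exact: interior_subset.
  have cYU : closed (Y `\` U m).
    by apply: closedI; [case: sY|exact: open_closedC].
  pose C := connected_component (Y `\` U m) x.
  have C0 : interior C = set0.
    apply: indecomposable_interior sY iY _ _ _.
    - exact: component_subcontinuum.
    - by move=> y /connected_component_sub[].
    - move=> CY; have [u Uu] := U0; have := UY _ Uu.
      by rewrite -CY => /connected_component_sub[].
  have [y Gy nCy] : exists2 y, interior G y & ~ C y.
    apply: contrapT => h; have : interior C y0.
      apply: (@in_interior (interior G)) => //; first exact: open_interior.
      by move=> z Gz; apply: contrapT => nCz; apply: h; exists z.
    by rewrite C0.
  have c1 := @closed_set1 _ _ y.
  have [|D [D' [[cD cD' DD' DD0] [Dx yD0]]]] :=
    component_clopen cX nX cYU c1 (conj Yx nUx).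
    by apply/seteqP; split=> // z [-> /nCy].
  have nD'x : ~ D' x by move=> D'x; rewrite -[False]/(set0 x) -DD0.
  have nDy : ~ D y by move=> Dy; rewrite -[False]/(set0 y) -yD0.
  have [F' [BF' F'F F'D]] := shrinkB _ _ _ BF (closed_openC cD') nD'x Fx.
  have [G' [BG' G'G G'D]] := shrinkB _ _ _ BG (closed_openC cD) nDy Gy.
  exists F', G'; split=> // x' y' /F'D nx' /G'D ny' [_ _ [L [[_ cL] LU Lx' Ly']]].
  have [||LD|LD'] := connected_closed_split cL cD cD'.
  - by rewrite DD'.
  - by rewrite DD0 setI0.
  - exact/ny'/LD.
  - exact/nx'/LD'.
- by split=> //; case: sY.
- exists f => u v uv [L [sL L0 Lu Lv]].
  have [||m [U0 UYL]] := UP (interior Y `\` L).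
  + by apply: openI; [exact: open_interior|apply: closed_openC; case: sL].
  + apply: contrapT => h; have [y Yy] := Y0.
    suff : interior L y by rewrite L0.
    apply: (@in_interior (interior Y)) => //; first exact: open_interior.
    by move=> z Yz; apply: contrapT => nLz; apply: h; exists z.
  apply: (fE _ _ uv m); split=> //.
    by move=> z /UYL[/interior_subset].
  exists (L `&` Y); split=> //; first exact: subcontinuumI.
  by move=> z [Lz Yz]; split=> // /UYL[_]; apply.
Qed.

(** * No indecomposable subcontinuum with interior *)

Section Chain.
Variables a b : X.
Hypothesis unlinked_ab : ~ linked a b.
Hypothesis nonisolated : forall x : X, ~ open [set x].
Hypothesis decomposable : forall Y, subcontinuum Y -> interior Y !=set0 ->
  ~ indecomposable Y.

Let K := hull [set a; b].

Let sK : subcontinuum K. Proof. exact: hull_subcontinuum. Qed.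

Let Ka : K a. Proof. by apply: sub_hull; left. Qed.

Let Kb : K b. Proof. by apply: sub_hull; right. Qed.

Let K_min L : subcontinuum L -> L a -> L b -> K `<=` L.
Proof. by move=> sL La Lb; apply: hull_sub => // x [->|->]. Qed.

Definition fat A A' := [/\ subcontinuum A, subcontinuum A', A a,
  A `<=` A' /\ A' `<=` K &
  interior A' `\` A !=set0].

(* Otherwise the hull of [W], the interior of [A'] minus [A], is indecomposable:
   if it were [P `|` Q], some continuum [Z] from [A] would reach [W], at a point
   of [P] say, without containing it, and [Z `|` P] would lie strictly between. *)
Lemma fat_dense A A' : fat A A' -> exists A'', fat A A'' /\ fat A'' A'.
Proof.
move=> [sA sA' Aa [AA' A'K] W0]; apply: contrapT => nodense.
set W := interior A' `\` A in W0.
have oW : open W.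
  by apply: openI; [exact: open_interior|apply: closed_openC; case: sA].
have WA' : W `<=` A' by move=> x [/interior_subset].
(* If both alternatives failed, [A''] would split the pair into two fat ones. *)
have gap A'' : subcontinuum A'' -> A `<=` A'' -> A'' `<=` A' ->
    interior A'' `<=` A \/ W `<=` A''.
  move=> sA'' AA'' A''A'; apply: contrapT => /not_orP[h1 h2]; apply: nodense.
  exists A''; split; split=> //.
  - by split=> //; exact: subset_trans A'K.
  - by apply: contrapT => h; apply: h1 => x A''x; apply: contrapT => nAx;
      apply: h; exists x.
  - exact: AA''.
  - apply: contrapT => h; apply: h2 => x [A'x _]; apply: contrapT => nA''x.
    by apply: h; exists x.
have sY : subcontinuum (hull W) := hull_subcontinuum W.
have WY : W `<=` hull W := @sub_hull W.
have YA' : hull W `<=` A' by exact: hull_sub.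
have [w Ww] := W0.
apply: (decomposable sY).
  by exists w; apply: in_interior Ww.
move=> P Q sP sQ PQ.
apply: contrapT => /not_orP[PY QY].
have small P1 : subcontinuum P1 -> P1 `<=` hull W -> P1 <> hull W ->
    exists2 z, W z & ~ P1 z.
  move=> sP1 P1Y P1n; apply: contrapT => h; apply: P1n; apply/seteqP; split=> //.
  apply: hull_sub => // z Wz; apply: contrapT => nP1z; apply: h.
  by exists z.
have [F [cF FW Fw]] := closed_shrink oW Ww.
have FoW : closure (interior F) `<=` W.
  apply: subset_trans FW; rewrite [X in _ `<=` X](closure_id F).1//.
  by apply: closureS; exact: interior_subset.
have oF : open (interior F) by exact: open_interior.
have nFA x : A x -> ~ interior F x by move=> Ax /interior_subset/FW[_ /(_ Ax)].
have cA'F : closed (A' `\` interior F).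
  by apply: closedI; [case: sA'|exact: open_closedC].
(* [Z] contains [A] but misses [w], so by [gap] its interior lies in [A]; by boundary bumping it
   still reaches [W]. *)
pose Z := connected_component (A' `\` interior F) a.
have sZ : subcontinuum Z by exact: component_subcontinuum.
have ZA' : Z `<=` A' by move=> x /connected_component_sub[].
have AZ : A `<=` Z.
  apply: connected_component_max => //; last by case: sA.
  by move=> x Ax; split; [exact: AA'|exact: nFA].
have ZA : interior Z `<=` A.
  have [//|WZ] := gap Z sZ AZ ZA'.
  by have /connected_component_sub[_] := WZ w Ww.
have [y [/FoW Wy Zy]] : (closure (interior F) `&` Z) !=set0.
  apply: (boundary_bumping cX nX) => //; [by case: sA'|by case: sA'|exact: AA'
    |exact: nFA|].
  by exists w; split=> //; exact: WA'.
have contra P1 Q1 : subcontinuum P1 -> subcontinuum Q1 -> P1 `|` Q1 = hull W ->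
    P1 <> hull W -> Q1 <> hull W -> P1 y -> False.
  move=> sP1 sQ1 PQ1 P1n Q1n P1y.
  have P1Y : P1 `<=` hull W by rewrite -PQ1; exact: subsetUl.
  have Q1Y : Q1 `<=` hull W by rewrite -PQ1; exact: subsetUr.
  have oWD L : subcontinuum L -> open (W `\` L).
    by move=> [cL _]; apply: openI => //; exact: closed_openC.
  (* Both outcomes fail: [W] minus [Q1] is a nonempty open part of [P1], and if [W] is covered, [W]
     minus [P1] is a nonempty open part of [Z]; both are disjoint from [A]. *)
  have [|||ZP1|WZP1] := gap (Z `|` P1).
  - by apply: subcontinuumU => //; exists y.
  - by apply: subset_trans AZ _; exact: subsetUl.
  - by rewrite subUset; split=> //; exact: subset_trans YA'.
  - have [z Wz nQ1z] := small _ sQ1 Q1Y Q1n.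
    case: (Wz) => _; apply; apply: ZP1.
    apply: (in_interior (oWD _ sQ1)); last by [].
    move=> t [Wt nQ1t]; right; have := WY _ Wt; rewrite -PQ1.
    by case.
  - have [z Wz nP1z] := small _ sP1 P1Y P1n.
    case: (Wz) => _; apply; apply: ZA.
    apply: (in_interior (oWD _ sP1)); last by [].
    by move=> t [Wt nP1t]; case: (WZP1 _ Wt).
have : (P `|` Q) y by rewrite PQ; exact: WY.
move=> [Py|Qy]; first exact: (contra P Q).
by apply: (contra Q P) => //; rewrite setUC.
Qed.

Lemma fat_proper A A' : fat A A' -> ~ A b.
Proof.
move=> [sA sA' Aa [_ A'K] [x [/interior_subset/A'K Kx nAx]]] Ab.
exact: (nAx (K_min sA Aa Ab Kx)).
Qed.

(** A continuum crossing the gap between [C1] and [C2] must contain the open set [C2] leaves there,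
    by minimality of [K]. *)
Lemma fat_unlinked C1 C2 A' x y : fat C1 C2 -> fat C2 A' ->
  C1 x -> closure (K `\` C2) y -> ~ linked x y.
Proof.
move=> fC fA' C1x Cy [L [sL L0 Lx Ly]].
have nC2b := fat_proper fA'.
have [sC1 sC2 C1a [C12 C2K] [z [C2z nC1z]]] := fC.
have cK := sK.1.
have DK : closure (K `\` C2) `<=` K.
  rewrite [X in _ `<=` X](closure_id K).1//; apply: closureS; exact: subDsetl.
have Db : closure (K `\` C2) b by apply: subset_closure.
(* Otherwise [K] is a union of two proper subcontinua containing [C2], hence [a]; one of them
   contains [b], against the minimality of [K]. *)
have sD : subcontinuum (closure (K `\` C2)).
  split; first exact: closed_closure.
  have [|//|[S [S' [sS sS' C2SS [[SK nKS] [S'K nKS']] SSK]]]] :=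
    complement_split cK sK.2 sC2.1 sC2.2 _ C2K.
  - by exists a; exact: C12.
  - have [Sa S'a] := C2SS _ (C12 _ C1a).
    have : (S `|` S') b by rewrite SSK.
    by move=> [Sb|S'b]; exfalso; [apply: nKS|apply: nKS']; exact: K_min.
(* The following union joins [a] to [b] inside [K], so it is [K]; hence [L]
   contains the interior of [C2] minus [C1]. *)
have sLK := subcontinuumI sL sK.
have sT : subcontinuum (C1 `|` (L `&` K) `|` closure (K `\` C2)).
  apply: subcontinuumU => //.
    by exists y; split=> //; right; split=> //; exact: DK.
  apply: subcontinuumU => //; exists x; split=> //; split=> //.
  by apply: C2K; apply: C12.
have KT := K_min sT (or_introl (or_introl C1a)) (or_intror Db).
suff : interior L z by rewrite L0.
apply: (@in_interior (interior C2 `\` C1)) => //.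
  by apply: openI; [exact: open_interior|apply: closed_openC; case: sC1].
move=> t [C2t nC1t]; have [[//|[]//]|Dt] := KT _ (C2K _ (interior_subset C2t)).
by have [s [[_ +] C2s]] := Dt _ C2t; rewrite /not => /(_ C2s).
Qed.

(** [K] has interior because [a] and [b] are unlinked, and more than [a] in it because [a] is not
    isolated. *)
Lemma fat_start : fat [set a] K.
Proof.
have K0 : interior K !=set0.
  apply/set0P/eqP => K0; apply: unlinked_ab; exists K; split=> //.
have c1 := @closed_set1 _ _ a.
split=> //.
- by split=> //; exact: connected1.
- by split=> // _ ->.
- apply: contrapT => h; have sub : interior K `<=` [set a].
    by move=> x Kx; apply: contrapT => nx; apply: h; exists x.
  apply: (@nonisolated a); suff <- : interior K = [set a] by exact: open_interior.
  apply/seteqP; split=> // _ ->; have [x Kx] := K0.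
  by rewrite -(sub _ Kx).
Qed.

Lemma decomposable_unlinked :
  exists f : (nat -> bool) -> X, forall u v, u <> v -> ~ linked (f u) (f v).
Proof.
(* The outer two of the three fat pairs are the children of [q]; the middle one is the gap between
   them. *)
have split_fat (q : set X * set X) : exists c : set X * set X, fat q.1 q.2 ->
    [/\ fat q.1 c.1, fat c.1 c.2 & fat c.2 q.2].
  have [fq|nfq] := pselect (fat q.1 q.2); last by exists q.
  have [C1 [f1 f2]] := fat_dense fq; have [C2 [f3 f4]] := fat_dense f2.
  by exists (C1, C2).
have [cut cutP] := choice split_fat.
pose st (u : nat -> bool) := fix st n := if n is m.+1 then
  let q := st m in if u m then ((cut q).2, q.2) else (q.1, (cut q).1)
  else ([set a], K).
have st_fat u n : fat (st u n).1 (st u n).2.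
  elim: n => [|n IH] /=; first exact: fat_start.
  by have [] := cutP _ IH; case: (u n).
(* The closed layer between the two continua of the pair; it shrinks as the pair is refined. *)
pose F u n := (st u n).2 `&` closure (K `\` (st u n).1).
have pt u : exists x, forall n, F u n x.
  apply: nested_compact => n.
  - have [_ [cA' _] _ _ _] := st_fat u n.
    by apply: closedI => //; exact: closed_closure.
  - have [_ _ _ [_ A'K] [x [/interior_subset A'x nAx]]] := st_fat u n.
    by exists x; split=> //; apply: subset_closure; split=> //; exact: A'K.
  - rewrite /F /=; have [[_ _ _ [c1 _] _] [_ _ _ [c2 _] _]
      [_ _ _ [c3 _] _]] := cutP _ (st_fat u n).
    case: (u n) => /=; apply: setISS => //.
      apply: closureS; apply: setDS; exact: subset_trans c2.
    exact: subset_trans c3.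
have [f fP] := choice pt; exists f.
(* At the first difference [n] the points lie on the two sides of the gap cut at level [n]. *)
have diff u v n : (forall m, (m < n)%N -> u m = v m) -> u n = false ->
    v n = true -> ~ linked (f u) (f v).
  move=> uv un vn; have stE : st u n = st v n.
    elim: n uv {un vn} => //= n IH uv.
    by rewrite IH ?uv// => m mn; apply: uv; exact: ltnW.
  have [f1 f2 f3] := cutP _ (st_fat u n).
  apply: (fat_unlinked f2 f3).
  - by have := fP u n.+1; rewrite /F /= un /= => -[].
  - by have := fP v n.+1; rewrite /F /= vn -stE /= => -[].
move=> u v uv; have : exists n, u n != v n.
  apply: contrapT => h; apply: uv; apply/funext => n; apply: contrapT => uvn.
  by apply: h; exists n; apply/eqP.
move=> /ex_minnP[n uvn nmin].
have uvE m : (m < n)%N -> u m = v m.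
  by move=> mn; apply/eqP; apply: contraLR mn => /nmin; rewrite -leqNgt.
case un: (u n) uvn; case vn: (v n) => // _; last exact: (diff u v n).
move=> [L [sL L0 Lu Lv]]; apply: (diff v u n) => //.
  by move=> m /uvE.
by exists L.
Qed.

End Chain.
End Continua.

(** * Counting meager composants *)

Section MeagerComposants.
Context {R : realType} {X : metricType R}.
Hypothesis cX : compact [set: X].

Lemma meager_composantP (x y : X) : meager_composant x y <-> linked x y.
Proof.
split=> [[L [[L0 cL Lc] nL Lx] Ly]|[L [[cL Lc] L0 Lx Ly]]].
  have clL : closed L by apply: compact_closed cL; exact: metric_hausdorff.
  exists L; split=> //; move: nL; rewrite /nowhere_dense.
  by have /closure_id <- := clL.
exists L => //; split=> //.
  by split=> //; [exists x|exact: (subclosed_compact cL cX)].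
by rewrite /nowhere_dense; have /closure_id <- := cL.
Qed.

(** A point is determined by the indices of the basic open sets around it. *)
Lemma card_le_set_nat : ([set: X] #<= [set: set nat])%card.
Proof.
have [U [oU Ub]] := countable_base cX.
pose g (x : X) := [set m | U m x].
have gI : injective g.
  move=> x y gxy; apply: contrapT => xy.
  have [|m [Ux Uy]] := Ub (~` [set y]) x (closed_openC (@closed_set1 _ _ y)).
    by move=> /= /xy.
  have : g y m by rewrite -gxy.
  by move/Uy; apply.
have /card_esym := @inj_card_eq _ _ [set: X] g (fun x y _ _ => @gI x y).
by move/card_le_eql ->; exact: subset_card_le.
Qed.

(** Each point lies in its own composant, so equal composants link their base points; hence [f]
    yields distinct composants for distinct subsets of the naturals. *)
Lemma unlinked_card (f : (nat -> bool) -> X) : (forall x : X, linked x x) ->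
  (forall u v, u <> v -> ~ linked (f u) (f v)) ->
  (meager_composants X #= [set: set nat])%card.
Proof.
move=> refl fP; rewrite card_eq_le; apply/andP; split.
  by apply: card_le_trans card_le_set_nat; exact: card_image_le.
pose h (S : set nat) := meager_composant (f (fun n => `[< S n >])).
have hI : injective h.
  move=> S S' hSS'; apply: contrapT => SS'.
  have /fP : (fun n => `[< S n >]) <> (fun n => `[< S' n >]).
    move=> E; apply: SS'; apply/seteqP; split=> n /asboolP.
      by rewrite (congr1 (@^~ n) E) => /asboolP.
    by rewrite -(congr1 (@^~ n) E) => /asboolP.
  apply; apply/meager_composantP; rewrite -/(h S) hSS'.
  by apply/meager_composantP; exact: refl.
have /card_esym := @inj_card_eq _ _ [set: set nat] h (fun x y _ _ => @hI x y).
move/card_le_eql ->; apply: subset_card_le => _ [S _ <-].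
by exists (f (fun n => `[< S n >])).
Qed.

End MeagerComposants.

Local Close Scope ring_scope.
Local Open Scope card_scope.

Theorem corollary15 (R : realType) (X : metricType R)
    (hX : tree_like_continuum X) :
  (meager_composants X #= `I_1) \/
  (meager_composants X #= [set: set nat]).
Proof.
have [[[x0 _] cX conX] _] := hX.
have [same|] := pselect (forall x y : X, meager_composant x = meager_composant y).
  left; suff -> : meager_composants X = [set meager_composant x0].
    exact: card_set1.
  by apply/seteqP; split=> [_ [x _ <-]|_ ->]; [exact: same|exists x0].
move=> /existsNP[p /existsNP[q pq]]; right.
(* An isolated point would be clopen, so [X] would be a single point and [p] would equal [q]. *)
have nonisolated (x : X) : ~ open [set x].
  move=> ox; apply: pq; suff E : [set x] = setT.
    have -> : p = x by rewrite -[_ = _]/([set x] p) E.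
    by have -> : q = x by rewrite -[_ = _]/([set x] q) E.
  by apply: conX; [exists x|exists [set x]; rewrite ?setTI|exists [set x];
    rewrite ?setTI//; exact: closed_set1].
have refl (x : X) : linked x x.
  exists [set x]; split=> //; first by split; [exact: closed_set1|exact: connected1].
  rewrite -subset0 => y xy; apply: (nonisolated x).
  suff <- : interior [set x] = [set x] by exact: open_interior.
  apply/seteqP; split=> [z|_ ->]; first exact: interior_subset.
  have yx : y = x by exact: (interior_subset xy).
  by rewrite yx in xy.
have cap (K L : set X) : subcontinuum K -> subcontinuum L -> connected (K `&` L).
  by move=> [cK Kc] [cL Lc]; exact: tree_like_connectedI.
suff [f fP] : exists f : (nat -> bool) -> X,
    forall u v, u <> v -> ~ linked (f u) (f v).
  exact: (unlinked_card cX refl fP).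
have [[Y [sY Y0 iY]]|noind] := pselect (exists Y : set X,
    [/\ subcontinuum Y, interior Y !=set0 & indecomposable Y]).
  exact: (indecomposable_unlinked cX cap sY iY Y0).
(* If all points were linked, every composant would be the whole space. *)
have [a [b ab]] : exists a b : X, ~ linked a b.
  apply: contrapT => h; apply: pq; apply/seteqP.
  have all (x y : X) : meager_composant x y.
    apply/(meager_composantP cX); apply: contrapT => xy.
    by apply: h; exists x, y.
  by split=> z _; exact: all.
apply: (decomposable_unlinked cX conX cap ab nonisolated) => Y sY Y0 iY.
by apply: noind; exists Y.
Qed.
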